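(* The quantized VCG mechanism (defined in the context) is dominant-strategy incentive-compatible: for every agent $n$ with true utility function $u_n$, every profile $\hat V_{-n}$ of reports of the other agents, and every report $\hat V_n'$ of agent $n$, the payoff $u_n(\frac{y_n^*}{M})-p_n$ of agent $n$ when she reports her true surrogate marginal utility vector $\hat V_n$ is at least her payoff when she reports $\hat V_n'$.
   Context: Setting: $\mathcal N=\{1,\dots,N\}$ is the set of agents, $N\ge2$. $f:2^{\mathcal N}\to\mathbb R$ is normalized ($f(\emptyset)=0$), monotone, submodular, with $f(\mathcal N)=1$ and strictly positive minimum distance $\triangle f=\min_{S\subseteq\mathcal N}\min_{i\ne j\in\mathcal N\setminus S}|f(S\cup\{i\})+f(S\cup\{j\})-f(S)-f(S\cup\{i,j\})|$. $M$ is an integer with $M\ge 2/\triangle f$, $\tilde f(S)=\lfloor f(S)M\rfloor$, and $P_{\tilde f}=\{\mathbf y\in\mathbb N^N:\sum_{n\in S}y_n\le\tilde f(S)\ \forall S\subseteq\mathcal N\}$, which is an integral polymatroid. Each agent $n$ has a private utility function $u_n$ on $[0,1]$ that is nonnegative, concave and strictly increasing with $\beta<u_n'<\alpha$, where $\alpha,\beta>0$ are publicly known constants. The true surrogate marginal utility vector of agent $n$ is $\hat V_n=(\hat v_{n1},\dots,\hat v_{n\tilde f(\{n\})})$ with $\hat v_{nm}=u_n(\frac mM)-u_n(\frac{m-1}M)-\frac\beta M$; it is nonnegative and non-increasing in $m$. Quantized VCG mechanism: each agent $n$ submits a (sealed) nonnegative non-increasing vector $\hat V_n=(\hat v_{n1},\dots,\hat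 v_{n\tilde f(\{n\})})$. The mechanism selects an allocation of divisions $\mathbf y^*$ maximizing $\sum_{n=1}^N\big(\sum_{m=1}^{y_n}\hat v_{nm}+\frac{\beta y_n}{M}\big)$ over $\mathbf y\in P_{\tilde f}$ (ties broken arbitrarily), and agent $n$ receives the amount $y_n^*/M$ of resource. Write $\mathrm{OPT}(\hat V)=\sum_{n=1}^N\sum_{m=1}^{y_n^*}\hat v_{nm}$ for the sum of the bids selected, and $\mathrm{OPT}(0,\hat V_{-n})$ for the same quantity when agent $n$'s report is replaced by the zero vector. Agent $n$ pays $$p_n=\mathrm{OPT}(0,\hat V_{-n})-\Big(\mathrm{OPT}(\hat V)-\sum_{m=1}^{y_n^*}\hat v_{nm}\Big)+\frac{y_n^*\beta}{M}.$$ *)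

(* Defs.v *)
From mathcomp Require Import all_boot all_order all_algebra.
From mathcomp Require Import all_classical all_reals all_analysis.

Set Implicit Arguments.
Unset Strict Implicit.
Unset Printing Implicit Defensive.

Import Order.TTheory GRing.Theory Num.Theory.
Import numFieldNormedType.Exports.

Local Open Scope ring_scope.

Section SetFunctions.
Variables (R : realType) (N : nat).
Implicit Types (f : {set 'I_N} -> R) (S A B : {set 'I_N}).

Definition normalized f : Prop := f finset.set0 = 0.

Definition monotone_setfun f : Prop := forall A B, A \subset B -> f A <= f B.

Definition submodular f : Prop :=
  forall A B, f (A :|: B) + f (A :&: B) <= f A + f B.

(* The set below is finite, and nonempty as soon as N >= 2, so that its
   infimum is a minimum. *)
Definition min_distance f : R :=
  inf [set d : R | exists S (i j : 'I_N),
    [/\ i != j, i \notin S, j \notin S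
      & d = `| f (i |: S) + f (j |: S) - f S - f (i |: (j |: S)) |] ]%classic.

(* On a nonnegative real, Num.truncn is the floor, as a natural number. *)
Definition quantized f (M : nat) S : nat := Num.truncn (f S * M%:R).

Definition in_polymatroid (r : {set 'I_N} -> nat) (y : {ffun 'I_N -> nat}) :
    Prop :=
  forall S, (\sum_(n in S) y n <= r S)%N.

End SetFunctions.

(* Only the values of u on [0, 1] matter.  The derivative is constrained on the
   open interval, and u is one-sidedly continuous at 0 and at 1; this is implied
   by (and slightly weaker than) differentiability on all of [0, 1]. *)
Record admissible_utility (R : realType) (alpha beta : R) (u : R -> R) :
    Prop := AdmissibleUtility {
  utility_ge0 : {in `[0, 1], forall x, 0 <= u x};
  utility_concave :
    convex_function (`[0, 1]%classic : set R^o) (fun x => - u x);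
  utility_increasing : {in `[0, 1] &, {homo u : x y / x < y}};
  utility_derivable : derivable_oo_LRcontinuous u 0 1;
  utility_slope : {in `]0, 1[, forall x, beta < derive1 u x < alpha} }.

Section QuantizedVCG.
Variables (R : realType) (N : nat) (f : {set 'I_N} -> R) (M : nat) (beta : R).

Definition capacity (n : 'I_N) : nat := quantized f M [set n]%SET.

(* The entry of index m (counted from 0) of a report is the bid for the division
   number m.+1. *)
Definition report (n : 'I_N) : Type := 'rV[R]_(capacity n).

Definition profile : Type := forall n : 'I_N, report n.

Definition replace_report (V : profile) (n : 'I_N) (v : report n) : profile :=
  eqtype.dfwith V v.

Definition valid_report (n : 'I_N) (v : report n) : Prop :=
  (forall m, 0 <= v 0 m) /\
  (forall m1 m2 : 'I_(capacity n), (m1 <= m2)%N -> v 0 m2 <= v 0 m1).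

Definition valid_profile (V : profile) : Prop :=
  forall n, valid_report (V n).

Definition zero_report (n : 'I_N) : report n := 0 : 'rV[R]_(capacity n).

Definition true_report (u : R -> R) (n : 'I_N) : report n :=
  \row_(m < capacity n)
    (u (m.+1%:R / M%:R) - u (m%:R / M%:R) - beta / M%:R).

(* Sum of the first k bids; k <= capacity n for the n-th component k of a vector
   of the polymatroid. *)
Definition bid_sum (n : 'I_N) (v : report n) (k : nat) : R :=
  \sum_(m < capacity n | (m < k)%N) v 0 m.

Definition objective (V : profile) (y : {ffun 'I_N -> nat}) : R :=
  \sum_n (bid_sum (V n) (y n) + beta * (y n)%:R / M%:R).

Definition optimal_allocation (V : profile) (y : {ffun 'I_N -> nat}) : Prop :=
  in_polymatroid (quantized f M) y /\
  forall z, in_polymatroid (quantized f M) z -> objective V z <= objective V y.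

(* Ties are broken arbitrarily: any rule choosing a maximizer is allowed. *)
Definition allocation_rule (alloc : profile -> {ffun 'I_N -> nat}) : Prop :=
  forall V, valid_profile V -> optimal_allocation V (alloc V).

Variable alloc : profile -> {ffun 'I_N -> nat}.

Definition OPT (V : profile) : R := \sum_n bid_sum (V n) (alloc V n).

Definition payment (V : profile) (n : 'I_N) : R :=
  OPT (replace_report V (zero_report n)) - (OPT V - bid_sum (V n) (alloc V n))
  + (alloc V n)%:R * beta / M%:R.

Definition payoff (u : R -> R) (V : profile) (n : 'I_N) : R :=
  u ((alloc V n)%:R / M%:R) - payment V n.

End QuantizedVCG.

(* Main.v *)
(* As in any VCG mechanism, the payoff of agent n is, up to a term that does not
   depend on her report, the true welfare of the selected allocation.  The
   mechanism however maximizes that welfare plus [beta / M] times the number of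
   divisions handed out (the true surrogate bids have [beta / M] subtracted).
   The extra term is the same for all profiles: the quantized rank function is
   again submodular because [M >= 2 / min_distance f], so every vector of the
   polymatroid that is not a base can be augmented, and as bids are nonnegative
   and [beta > 0] every optimal allocation is a base. *)

Require Import Defs.
From mathcomp Require Import all_boot all_order all_algebra.
From mathcomp Require Import all_classical all_reals all_analysis.
From mathcomp Require Import zify ring lra.

Import Order.TTheory GRing.Theory Num.Theory.
Import numFieldNormedType.Exports.

Local Open Scope ring_scope.

(** * Submodularity of integer rank functions, and augmentation *)

Section IntegralPolymatroid.
Variables (T : finType) (r : {set T} -> nat).

Hypothesis local_submod : forall (S : {set T}) i j, i != j -> i \notin S -> j \notin S ->
  (r S + r (i |: (j |: S)) <= r (i |: S) + r (j |: S))%N.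

(** Moving the elements of [B :\: A] into [A] one at a time, the local condition shows that the
    marginal value of [i] never increases. *)
Lemma diminishing_returns (A B : {set T}) i : A \subset B -> i \notin B ->
  (r (i |: B) + r A <= r (i |: A) + r B)%N.
Proof.
have [k] := ubnP #|B :\: A|; elim: k => // k IHk in A *; rewrite ltnS => lek.
move=> sAB iNB; have [sBA|] := boolP (B \subset A).
  have -> : A = B by apply/eqP; rewrite finset.eqEsubset sAB sBA.
  by [].
case/fintype.subsetPn => j jB jNA.
have iNA : i \notin A by apply: contra iNB; apply/(fintype.subsetP sAB).
have ij : i != j by apply: contraNneq iNB => ->.
have := IHk (j |: A).
have -> : (#|B :\: (j |: A)| < k)%N.
  apply: leq_trans lek; apply: proper_card; apply/properP; split.
    by rewrite finset.setDS // finset.subsetUr.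
  by exists j; rewrite !finset.inE ?jNA ?eqxx //.
have -> : j |: A \subset B by rewrite finset.subUset finset.sub1set jB.
move=> /(_ isT isT iNB); have := local_submod _ _ _ ij iNA jNA; lia.
Qed.

(** Dropping some [i] of [A :\: B] from [A] keeps the intersection with [B]; putting it back raises
    [r] at least as much on [A] as on the union. *)
Lemma submodular_of_local (A B : {set T}) : (r (A :|: B) + r (A :&: B) <= r A + r B)%N.
Proof.
have [k] := ubnP #|A :\: B|; elim: k => // k IHk in A *; rewrite ltnS => lek.
have [sAB|] := boolP (A \subset B).
  by rewrite (finset.setUidPr sAB) (finset.setIidPl sAB) addnC.
case/fintype.subsetPn => i iA iNB.
have ltk : (#|(A :\ i)%SET :\: B| < k)%N.
  apply: leq_trans lek; apply: proper_card; apply/properP; split.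
    by rewrite finset.setSD // finset.subsetDl.
  by exists i; rewrite !finset.inE ?eqxx ?andbF ?iA ?iNB.
have := IHk _ ltk.
have := diminishing_returns (A :\ i)%SET ((A :\ i)%SET :|: B) i (finset.subsetUl _ _).
rewrite finset.setUA (finset.setD1K iA).
have -> : (A :\ i)%SET :&: B = A :&: B.
  apply/finset.setP => x; rewrite !finset.inE.
  by have [->|//] := eqVneq x i; rewrite (negPf iNB) !andbF.
have -> : i \notin (A :\ i)%SET :|: B by rewrite !finset.inE eqxx.
by move=> /(_ isT); lia.
Qed.

Hypothesis r0 : r finset.set0 = 0%N.

(* The tight sets (those with [sum y = r]) are closed under union, so a maximal
   one either is everything or leaves out a coordinate that can be raised. *)
Lemma polymatroid_augment (y : T -> nat) :
    (forall S : {set T}, (\sum_(i in S) y i <= r S)%N) ->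
    (\sum_i y i < r finset.setT)%N ->
  exists i, forall S : {set T}, (\sum_(j in S) (y j + (j == i)) <= r S)%N.
Proof.
move=> yP lty.
pose tight := [pred S : {set T} | \sum_(i in S) y i == r S]%N.
have tight0 : tight finset.set0 by rewrite /= big_set0 r0.
have exT : exists S, tight S by exists finset.set0.
have [S /maxsetP[/= /eqP tS maxS]] := ex_maxset exT.
have [i iNS] : exists i, i \notin S.
  apply/existsP; rewrite -negb_forall; apply/negP => /forallP allS.
  have ST : S = finset.setT by apply/finset.setP => i; rewrite allS finset.inE.
  move: lty; rewrite -ST -tS ST [X in (_ < X)%N](eq_bigl predT) ?ltnn //.
  by move=> i; rewrite finset.inE.
exists i => A; rewrite big_split /=.
have [iA|iNA] := boolP (i \in A); last first.
  rewrite [X in (_ + X)%N]big1 ?addn0 // => j jA.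
  by case: eqVneq iNA => // <-; rewrite jA.
rewrite [X in (_ + X)%N](bigD1 i) //= eqxx [X in (true + X)%N]big1 ?addn0; last first.
  by move=> j /andP[_ /negPf ->].
rewrite addn1 ltn_neqAle yP andbT; apply/negP => tA.
(* The sum of [y] is modular, so submodularity of [r] and feasibility on [A :&: S] leave no slack on
   the union. *)
have : tight (A :|: S).
  have UI : (\sum_(i in A :|: S) y i + \sum_(i in A :&: S) y i
             = \sum_(i in A) y i + \sum_(i in S) y i)%N.
    rewrite (big_setID A) /= finset.setUK finset.setDUl finset.setDv.
    by rewrite finset.set0U (big_setID (A := S) A) /= (finset.setIC S); lia.
  rewrite /= eqn_leq yP; have := submodular_of_local A S.
  have := yP (A :&: S); move: UI; rewrite (eqP tA) tS; lia.
move=> /maxS /(_ (finset.subsetUr _ _)) AS.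
by rewrite -AS finset.inE iA in iNS.
Qed.
End IntegralPolymatroid.

(** * Increments of an admissible utility *)

Lemma midpoint_concave (R : realType) (u : R -> R) (x y : R) :
    convex_function (`[0, 1]%classic : set R^o) (fun x => - u x) ->
    x \in `[0, 1] -> y \in `[0, 1] ->
  u x + u y <= 2 * u ((x + y) / 2).
Proof.
move=> cu x01 y01.
have h0 : 0 <= 2^-1 :> R by lra.
have h1 : 2^-1 <= 1 :> R by lra.
pose t : {i01 R} := Itv01 h0 h1.
have : - u (2^-1 * x + (1 - 2^-1) * y) <= 2^-1 * - u x + (1 - 2^-1) * - u y.
  by have := cu t x y; rewrite !inE; apply.
have -> : 2^-1 * x + (1 - 2^-1) * y = (x + y) / 2 by field.
lra.
Qed.

Section AdmissibleUtility.
Variables (R : realType) (alpha beta : R) (u : R -> R).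
Hypothesis hu : admissible_utility alpha beta u.

(** By the mean value theorem; one-sided continuity covers the endpoints 0 and 1. This makes the
    true bids nonnegative. *)
Lemma utility_increment_ge (a b : R) : 0 <= a -> a < b -> b <= 1 ->
  beta * (b - a) <= u b - u a.
Proof.
move=> a0 ab b1.
have sub : (`[a, b] `<=` `[0, 1])%classic.
  by move=> x /=; rewrite !in_itv /= => /andP[? ?]; apply/andP; split; lra.
have [du _ _ ] := derivable_oo_continuousW ab sub (utility_derivable hu).
have cu := derivable_oo_LRcontinuous_within
  (derivable_oo_continuousW ab sub (utility_derivable hu)).
have du' x : x \in `]a, b[ -> is_derive x 1 u (derive1 u x).
  by move=> xab; rewrite derive1E; apply: DeriveDef => //; apply: du.
have [c cab ->] := MVT ab du' cu.
rewrite ler_wpM2r //; first by lra.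
have c01 : c \in `]0, 1[.
  by move: cab; rewrite !in_itv /= => /andP[? ?]; apply/andP; split; lra.
by have /andP[/ltW] := utility_slope hu c01.
Qed.

(** Midpoint concavity at a grid point compares the two increments adjacent to it; induction on [m]
    chains these comparisons. *)
Lemma grid_increment_nonincreasing (M k m : nat) : (0 < M)%N ->
    (k + m < M)%N ->
  u ((k + m).+1%:R / M%:R) - u ((k + m)%:R / M%:R)
    <= u (k.+1%:R / M%:R) - u (k%:R / M%:R).
Proof.
move=> M0; have M0' : 0 < M%:R :> R by rewrite ltr0n.
have grid01 i : (i <= M)%N -> (i%:R / M%:R : R) \in `[0, 1].
  by move=> iM; rewrite in_itv /= divr_ge0 //= ler_pdivrMr // mul1r ler_nat.
elim: m => [|m IHm]; first by rewrite addn0.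
rewrite addnS => kmM; apply: le_trans (IHm (ltnW kmM)).
have i1 : (k + m <= M)%N by lia.
have := midpoint_concave _ _ _ _ (utility_concave hu) (grid01 _ i1) (grid01 _ kmM).
have -> : ((k + m)%:R / M%:R + (k + m).+2%:R / M%:R) / 2 = (k + m).+1%:R / M%:R :> R.
  by rewrite -!natr1; field; rewrite gt_eqF.
lra.
Qed.

End AdmissibleUtility.

(** * The quantized rank function *)

Section Quantization.
Variables (R : realType) (N : nat) (f : {set 'I_N} -> R) (M : nat).
Hypotheses (f_norm : normalized f) (f_mono : monotone_setfun f).
Hypotheses (f_subm : submodular f) (f_dist : 0 < min_distance f).
Hypothesis hM : 2 / min_distance f <= M%:R.

Lemma setfun_ge0 (S : {set 'I_N}) : 0 <= f S.
Proof. by rewrite -f_norm f_mono // finset.sub0set. Qed.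

Lemma quantized_set0 : quantized f M finset.set0 = 0%N.
Proof. by rewrite /quantized f_norm mul0r truncn0. Qed.

Lemma min_distance_le (S : {set 'I_N}) i j : i != j -> i \notin S -> j \notin S ->
  min_distance f <= f (i |: S) + f (j |: S) - f S - f (i |: (j |: S)).
Proof.
move=> ij iS jS; apply: ge_inf.
  by exists 0 => _ [A [k [l [_ _ _ ->]]]]; apply: normr_ge0.
exists S, i, j; split => //; rewrite ger0_norm //.
have := f_subm (i |: S) (j |: S).
have -> : (i |: S) :|: (j |: S) = i |: (j |: S).
  by rewrite finset.setUACA finset.setUid finset.setUA.
have -> : (i |: S) :&: (j |: S) = S.
  apply/finset.setP => x; rewrite !finset.inE.
  have [->|_] := eqVneq x i; last by case: (x \in S); rewrite ?orbT ?andbF ?orbF.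
  by rewrite (negPf ij) (negPf iS).
lra.
Qed.

Lemma divisions_gt0 : (0 < M)%N.
Proof.
by rewrite -(ltr0n R); apply: lt_le_trans hM; rewrite divr_gt0.
Qed.

(* The two floors on the larger side lose less than 2 in total, and
   [M * min_distance f >= 2] pays for that. *)
Lemma quantized_local_submodular (S : {set 'I_N}) i j :
    i != j -> i \notin S -> j \notin S ->
  (quantized f M S + quantized f M (i |: (j |: S))
     <= quantized f M (i |: S) + quantized f M (j |: S))%N.
Proof.
move=> ij iS jS; have dle := min_distance_le _ _ _ ij iS jS.
have fl A : (quantized f M A)%:R <= f A * M%:R < (quantized f M A)%:R + 1.
  by rewrite natr1 truncn_itv // mulr_ge0 ?setfun_ge0.
have M2 : 2 <= M%:R * min_distance f by rewrite -ler_pdivrMr.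
have : 2 <= (f (i |: S) + f (j |: S) - f S - f (i |: (j |: S))) * M%:R.
  by apply: (le_trans M2); rewrite mulrC ler_wpM2r.
move: (fl S) (fl (i |: S)) (fl (j |: S)) (fl (i |: (j |: S))).
move=> /andP[? ?] /andP[? ?] /andP[? ?] /andP[? ?] ?.
by rewrite -(ler_nat R) !natrD; lra.
Qed.

(** Keeps the grid points used by [true_report] in the unit interval, where [u] is constrained. *)
Lemma capacity_le (n : 'I_N) : f finset.setT = 1 -> (capacity f M n <= M)%N.
Proof.
move=> fT; rewrite -[leqRHS](@natrK R); apply: le_truncn.
by rewrite ler_piMl // -fT f_mono // finset.subsetT.
Qed.

End Quantization.

(** * Optimal allocations and payoffs *)

Section Mechanism.
Variables (R : realType) (N : nat) (f : {set 'I_N} -> R) (M : nat) (beta : R).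
Implicit Types (V : profile f M) (y : {ffun 'I_N -> nat}) (n : 'I_N).

Lemma bid_sum_le n (v : report f M n) k1 k2 : valid_report v ->
  (k1 <= k2)%N -> bid_sum v k1 <= bid_sum v k2.
Proof.
move=> [v0 _] k12; rewrite /bid_sum [leLHS]big_mkcond [leRHS]big_mkcond /=.
apply: ler_sum => m _; have [mk1|_] := ltnP m k1.
  by rewrite (leq_trans mk1 k12).
by case: ifP.
Qed.

Lemma objectiveE V y :
  objective beta V y
    = \sum_n bid_sum (V n) (y n) + beta / M%:R * (\sum_n y n)%N%:R.
Proof.
rewrite /objective big_split /= natr_sum mulr_sumr; congr (_ + _).
by apply: eq_bigr => n _; rewrite mulrAC.
Qed.

Lemma in_polymatroid_capacity y n :
  in_polymatroid (quantized f M) y -> (y n <= capacity f M n)%N.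
Proof. by move=> /(_ [set n]%SET); rewrite big_set1. Qed.

(** The increments of [u] telescope. The bound on [k] matters because [bid_sum] stops at the
    capacity. *)
Lemma bid_sum_true_report (u : R -> R) n k : (k <= capacity f M n)%N ->
  bid_sum (true_report f M beta u n) k = u (k%:R / M%:R) - u 0 - k%:R * beta / M%:R.
Proof.
move=> kc; rewrite /bid_sum.
under eq_bigr do rewrite mxE.
rewrite -(big_ord_widen _
  (fun m => u (m.+1%:R / M%:R) - u (m%:R / M%:R) - beta / M%:R) kc).
rewrite -(big_mkord xpredT
  (fun m => u (m.+1%:R / M%:R) - u (m%:R / M%:R) - beta / M%:R)).
rewrite big_split /= (telescope_sumr (fun m => u (m%:R / M%:R)) (leq0n k)).
by rewrite mul0r sumr_const_nat subn0 mulNrn -[(_ / _) *+ k]mulr_natl mulrA.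
Qed.

(** Shows that the [OPT] term at the zero report in [payment] does not depend on the agent's own
    report. *)
Lemma replace_replace_report V n (v w : report f M n) :
  replace_report (replace_report V v) w = replace_report V w.
Proof.
apply: functional_extensionality_dep => i; rewrite /replace_report.
have [->|ni] := eqVneq i n; first by rewrite !dfwith_in.
by rewrite !dfwith_out // eq_sym.
Qed.

Lemma replace_report_valid V n (v : report f M n) :
    (forall j, j != n -> valid_report (V j)) -> valid_report v ->
  valid_profile (replace_report V v).
Proof.
move=> Vok vok i; rewrite /replace_report.
have [->|ni] := eqVneq i n; first by rewrite dfwith_in.
by rewrite dfwith_out 1?eq_sym //; apply: Vok.
Qed.

Section Optimal.
Hypotheses (f_norm : normalized f) (f_mono : monotone_setfun f).
Hypotheses (f_subm : submodular f) (f_dist : 0 < min_distance f).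
Hypotheses (hM : 2 / min_distance f <= M%:R) (beta_gt0 : 0 < beta).

Let M_gt0 : 0 < M%:R :> R.
Proof. by rewrite ltr0n (divisions_gt0 _ _ _ _ f_dist hM). Qed.

Lemma optimal_allocation_sum V y : valid_profile V ->
  optimal_allocation beta V y -> (\sum_i y i)%N = quantized f M finset.setT.
Proof.
move=> Vok [yP yopt]; apply/eqP; rewrite eqn_leq.
have yT : (\sum_i y i <= quantized f M finset.setT)%N.
  apply: leq_trans (yP finset.setT).
  by under [leqRHS]eq_bigl do rewrite finset.in_setT.
rewrite yT /= leqNgt; apply/negP => lty.
have [i zP] := polymatroid_augment _ _
  (quantized_local_submodular _ _ _ _ f_norm f_mono f_subm f_dist hM)
  (quantized_set0 _ _ _ _ f_norm) _ yP lty.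
pose z := [ffun j => y j + (j == i)]%N.
have zin : in_polymatroid (quantized f M) z.
  by move=> S; under eq_bigr do rewrite ffunE.
have := yopt z zin; rewrite !objectiveE leNgt => /negP; apply.
(* The extra division lowers no bid sum; since its bid may be zero, the strict gain comes from
   [beta / M]. *)
apply: ler_ltD.
  by apply: ler_sum => j _; rewrite ffunE bid_sum_le // leq_addr.
rewrite ltr_pM2l ?divr_gt0 // ltr_nat; under [ltnRHS]eq_bigr do rewrite ffunE.
by rewrite big_split /= -[ltnLHS]addn0 ltn_add2l (bigD1 i) //= eqxx.
Qed.

Lemma true_report_valid alpha u n : f finset.setT = 1 ->
  admissible_utility alpha beta u -> valid_report (true_report f M beta u n).
Proof.
move=> fT hu; have cap := capacity_le _ _ _ M f_mono n fT.
split => [m|m1 m2 m12]; rewrite !mxE.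
  have mM : (m < M)%N := leq_trans (ltn_ord m) cap.
  have lt : m%:R / M%:R < m.+1%:R / M%:R :> R.
    by rewrite ltr_pM2r ?invr_gt0 // ltr_nat.
  have le1 : m.+1%:R / M%:R <= 1 :> R.
    by rewrite ler_pdivrMr // mul1r ler_nat.
  have ge0 : 0 <= m%:R / M%:R :> R by rewrite divr_ge0.
  have := utility_increment_ge _ _ _ _ hu _ _ ge0 lt le1.
  have -> : beta * (m.+1%:R / M%:R - m%:R / M%:R) = beta / M%:R.
    by rewrite -mulrBl -natrB // subSnn mul1r.
  lra.
rewrite lerB //.
have := grid_increment_nonincreasing _ _ _ _ hu M m1 (m2 - m1).
rewrite subnKC //; apply; first by rewrite -(ltr0n R).
exact: leq_trans (ltn_ord m2) cap.
Qed.

End Optimal.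

(** The payment returns the others' selected bids, and its [beta] part cancels the one left by
    telescoping the true bids. The report [w] then acts only through the allocation [y]. *)
Lemma payoffE (alloc : profile f M -> {ffun 'I_N -> nat}) u V n
    (w : report f M n) :
  let y := alloc (replace_report V w) in
  in_polymatroid (quantized f M) y ->
  payoff beta alloc u (replace_report V w) n
    = u 0 + objective beta (replace_report V (true_report f M beta u n)) y
      - beta / M%:R * (\sum_i y i)%N%:R
      - OPT alloc (replace_report V (zero_report f M n)).
Proof.
move=> y yP; have sumE (v : report f M n) :
    \sum_j bid_sum (replace_report V v j) (y j)
      = bid_sum v (y n) + \sum_(j | j != n) bid_sum (V j) (y j).
  rewrite (bigD1 n) //= {1}/replace_report dfwith_in; congr (_ + _).
  by apply: eq_bigr => j nj; rewrite /replace_report dfwith_out // eq_sym.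
rewrite /payoff /payment replace_replace_report; set o := OPT _ _.
rewrite objectiveE /OPT -/y !sumE {1}/replace_report dfwith_in.
rewrite bid_sum_true_report ?in_polymatroid_capacity //.
ring.
Qed.

End Mechanism.

Theorem corollary3p9 (R : realType) (N : nat) (hN : (2 <= N)%N)
    (f : {set 'I_N} -> R)
    (f_norm : normalized f) (f_mono : monotone_setfun f) (f_subm : submodular f)
    (f_full : f finset.setT = 1)
    (f_dist : 0 < min_distance f)
    (M : nat) (hM : 2 / min_distance f <= M%:R)
    (alpha beta : R) (alpha_gt0 : 0 < alpha) (beta_gt0 : 0 < beta)
    (alloc : profile f M -> {ffun 'I_N -> nat})
    (alloc_opt : allocation_rule beta alloc)
    (n : 'I_N) (u : R -> R) (hu : admissible_utility alpha beta u)
    (V : profile f M) (V_others : forall j, j != n -> valid_report (V j))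
    (v' : report f M n) (hv' : valid_report v') :
  payoff beta alloc u (replace_report V v') n
    <= payoff beta alloc u (replace_report V (true_report f M beta u n)) n.
Proof.
have validT : valid_report (true_report f M beta u n).
  by apply: true_report_valid hu.
have opt (w : report f M n) : valid_report w ->
    optimal_allocation beta (replace_report V w) (alloc (replace_report V w)).
  by move=> wok; apply: alloc_opt; exact: replace_report_valid.
have sumE (w : report f M n) : valid_report w ->
    (\sum_i alloc (replace_report V w) i)%N = quantized f M finset.setT.
  move=> wok; have Vok := replace_report_valid _ _ _ _ _ _ _ V_others wok.
  by apply: optimal_allocation_sum Vok (opt w wok).
have [yP' _] := opt _ hv'; have [yPT yopt] := opt _ validT.
(* With equal totals, the payoffs differ only in the truthful objective, evaluated at two feasible
   allocations; the truthful one maximizes it. *)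
rewrite !payoffE // (sumE _ hv') (sumE _ validT).
by rewrite !lerD2r lerD2l; apply: yopt.
Qed.
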